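(* Let $d\ge1$, $n\in\{1,2,\dots\}\cup\{\infty\}$, and let $\{\xi(i,m)\}$, $1\le i\le n$ ($i$ finite), $m=1,\dots,d$, be centered martingale differences relative to one common filtration $\{F(i)\}$, such that for each fixed $m$ the random variables $\xi(1,m),\xi(2,m),\dots$ are independent (the vectors $\vec\xi(m)=\{\xi(i,m)\}_i$ for different $m$ may be dependent). Put $\nu_m(p)=\sup_i|\xi(i,m)|_p$ and assume that, for each $m$, $\nu_m\in G(\nu,r_m)$ for some $2<r_m<\infty$, and that $r=\left(\sum_{m=1}^d1/r_m\right)^{-1}>1$. Define for $p\ge2$ $$\zeta_1(p)=K_I(p)\,\nu_1(p),\qquad \zeta_{m+1}(p)=K_M(p)\,(\zeta_m\otimes\nu_{m+1})(p),\quad m=1,\dots,d-1.$$ Then $$\sup_{b\in B(d,n)}\|Q(d,n,b)\|G(\zeta_d)\ \le\ \prod_{m=1}^d\|\vec\xi(m)\|G(\nu_m,r_m),$$ where $\|Q\|G(\zeta_d)=\sup_{p\in(2,r)}|Q|_p/\zeta_d(p)$ and $\|\vec\xi(m)\|G(\nu_m,r_m)=\sup_{p\in(2,r_m)}\sup_i|\xi(i,m)|_p/\nu_m(p)$.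
   Context: All random variables live on a probability space $(\Omega,F,\mathbf P)$; $|\xi|_p=(\mathbf E|\xi|^p)^{1/p}$. Suprema of nonnegative quantities over the empty set are $0$. Martingale differences: $F(0)=\{\emptyset,\Omega\}$, $F(i)\subset F(i+1)\subset F$; each $\xi(i,m)$ is $F(i)$-measurable, $\mathbf E\xi(i,m)=0$, and $\mathbf E[\xi(i,m)\mid F(k)]=0$ a.s. for all $k=0,1,\dots,i-1$. The filtration is the same for all $m=1,\dots,d$. Polynomial: $I(d,n)=\{(i_1,\dots,i_d):1\le i_1<i_2<\dots<i_d\le n\}$ (finite indices); for a real non-random array $b=(b(I))_{I\in I(d,n)}$, $$Q(d,n,b)=\sum_{I=(i_1,\dots,i_d)\in I(d,n)}b(I)\prod_{m=1}^d\xi(i_m,m).$$ For $n=\infty$, $Q(d,\infty,b)=\lim_{n\to\infty}Q(d,n,b)$, for those $b$ for which this limit exists with probability one. $B(d,n)=\{b:\sum_{I\in I(d,n)}b^2(I)=1\}$. Class $G(\nu,r)$ ($r>2$): functions $\nu$ that are continuous, positive and finite on $[1,r)$, with $\inf_{p\in(2,r)}\nu(p)>0$ and $\nu(p)=\infty$ for $p>r$. Operation $\otimes$: $(\nu_1\otimes\nu_2)(p)=\inf\{\nu_1(p/a)\,\nu_2(p/b):a,b>0,\ a+b=1\}$, for functions with values in $(0,\infty]$. Constant $K_M(p)$, $p\ge2$: the smallest constant $K$ such that for every finite $n$, every sequence $\theta(1),\dots,\theta(n)$ of centered martingale differences relative to some filtration, and all real $b(1),\dots,b(n)$ with $\sum_i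 b^2(i)=1$, one has $\left|\sum_{i=1}^n b(i)\theta(i)\right|_p\le K\sup_i|\theta(i)|_p$. (It is known that $K_M(p)\le p\sqrt2$.) Constant $K_I(p)$, $p\ge2$: the smallest constant in the same inequality when $\theta(1),\dots,\theta(n)$ are restricted to be independent centered random variables. (It is known that $K_I(p)\le 0.87\,p/\log p$.) *)

(* Defs.v *)
From HB Require Import structures.
From mathcomp Require Import all_boot all_order all_algebra finmap.
From mathcomp Require Import all_classical all_reals all_analysis.

Set Implicit Arguments.
Unset Strict Implicit.
Unset Printing Implicit Defensive.
Import Order.TTheory GRing.Theory Num.Theory.
Import numFieldNormedType.Exports.
Local Open Scope classical_set_scope.
Local Open Scope ring_scope.

(* Supremum of a set of nonnegative extended reals, with sup of set0 equal to
   0 (ereal_sup set0 is -oo). *)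
Definition nnsup (R : realType) (A : set (\bar R)) : \bar R :=
  ereal_sup (0%E |` A).

Definition pnorm (R : realType) (disp : measure_display)
    (T : measurableType disp) (P : probability T R) (p : R) (X : T -> R) :
    \bar R :=
  'N[P]_(p%:E)[EFin \o X].

(* A horizon n in {1, 2, ...} or infinity is an option nat, None standing for
   infinity; times start at 1. *)
Definition times (n : option nat) : set nat :=
  [set i | (1 <= i)%N /\ (if n is Some k then (i <= k)%N else true)].

Definition measurable_wrt (R : realType) (T : Type) (G : set (set T))
    (X : T -> R) : Prop :=
  forall B : set R, measurable B -> G (X @^-1` B).

Definition is_cond_exp (R : realType) (disp : measure_display)
    (T : measurableType disp) (P : probability T R) (G : set (set T))
    (X Y : T -> R) : Prop :=
  [/\ P.-integrable setT (EFin \o X),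
      P.-integrable setT (EFin \o Y),
      measurable_wrt G Y &
      forall A, G A ->
        (\int[P]_(x in A) (X x)%:E = \int[P]_(x in A) (Y x)%:E)%E].

Definition filtration (disp : measure_display) (T : measurableType disp)
    (F : nat -> set (set T)) : Prop :=
  [/\ F 0%N = [set set0; setT],
      forall i, sigma_algebra setT (F i),
      forall i, F i `<=` F i.+1 &
      forall i, F i `<=` measurable].

Definition martingale_differences (R : realType) (disp : measure_display)
    (T : measurableType disp) (P : probability T R) (n : option nat)
    (F : nat -> set (set T)) (X : nat -> {RV P >-> R}) : Prop :=
  forall i, times n i ->
    [/\ measurable_wrt (F i) (X i),
        P.-integrable setT (EFin \o X i),
        ('E_P[X i] = 0)%E &
        forall k, (k < i)%N -> is_cond_exp P (F k) (X i) (cst 0)].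

Definition independent_RVs (R : realType) (disp : measure_display)
    (T : measurableType disp) (P : probability T R) (D : set nat)
    (X : nat -> {RV P >-> R}) : Prop :=
  forall (J : {fset nat}) (B : nat -> set R),
    [set` J] `<=` D -> (forall j, measurable (B j)) ->
    (P (\bigcap_(j in [set` J]) (X j @^-1` B j)) =
     \prod_(j <- J) P (X j @^-1` B j))%E.

Definition weighted_sum_bound (R : realType) (disp : measure_display)
    (T : measurableType disp) (P : probability T R) (p : R) (n : nat)
    (theta : nat -> {RV P >-> R}) (K : R) : Prop :=
  forall b : nat -> R, \sum_(1 <= i < n.+1) b i ^+ 2 = 1 ->
    (pnorm P p (fun x => \sum_(1 <= i < n.+1) b i * theta i x)%R <=
     K%:E * nnsup [set pnorm P p (theta i) | i in times (Some n)])%E.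

(* The best constants are universal: the probability space varies too. They
   are infima in the extended reals, hence +oo if no constant works. *)
Definition K_M (R : realType) (p : R) : \bar R :=
  ereal_inf [set K%:E | K in [set K : R |
    forall (disp : measure_display) (T : measurableType disp)
      (P : probability T R) (n : nat) (F : nat -> set (set T))
      (theta : nat -> {RV P >-> R}),
      filtration F -> martingale_differences (Some n) F theta ->
      weighted_sum_bound p n theta K]].

Definition K_I (R : realType) (p : R) : \bar R :=
  ereal_inf [set K%:E | K in [set K : R |
    forall (disp : measure_display) (T : measurableType disp)
      (P : probability T R) (n : nat) (theta : nat -> {RV P >-> R}),
      (forall i, times (Some n) i ->
         P.-integrable setT (EFin \o theta i) /\ ('E_P[theta i] = 0)%E) ->
      independent_RVs (times (Some n)) theta ->
      weighted_sum_bound p n theta K]].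

Definition multi_indices (d : nat) (n : option nat) : set (d.-tuple nat) :=
  [set I : d.-tuple nat | sorted ltn I /\ (forall m, times n (tnth I m))].
Arguments multi_indices : clear implicits.

(* In xi i m, the time i starts at 1 and the coordinate m < d at 0. *)
Definition Qfin (R : realType) (disp : measure_display)
    (T : measurableType disp) (P : probability T R)
    (xi : nat -> nat -> {RV P >-> R}) (d n : nat) (b : d.-tuple nat -> R)
    (x : T) : R :=
  \sum_(I \in multi_indices d (Some n)) b I * \prod_(m < d) xi (tnth I m) m x.

Definition Q (R : realType) (disp : measure_display)
    (T : measurableType disp) (P : probability T R)
    (xi : nat -> nat -> {RV P >-> R}) (d : nat) (n : option nat)
    (b : d.-tuple nat -> R) (x : T) : R :=
  if n is Some k then Qfin xi k b x else limn (fun k => Qfin xi k b x).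

Definition Q_defined (R : realType) (disp : measure_display)
    (T : measurableType disp) (P : probability T R)
    (xi : nat -> nat -> {RV P >-> R}) (d : nat) (n : option nat)
    (b : d.-tuple nat -> R) : Prop :=
  if n is Some _ then True
  else {ae P, forall x, cvgn (fun k => Qfin xi k b x)}.

Definition unit_arrays (R : realType) (d : nat) (n : option nat) :
    set (d.-tuple nat -> R) :=
  [set b | (\esum_(I in multi_indices d n) (b I ^+ 2)%:E = 1)%E].
Arguments unit_arrays : clear implicits.

Definition class_G (R : realType) (r : R) (nu : R -> \bar R) : Prop :=
  [/\ {within `[1, r[, continuous nu},
      (forall p, 1 <= p < r -> (0 < nu p < +oo)%E),
      (0 < ereal_inf [set nu p | p in `]2%R, r[])%E &
      (forall p, r < p -> nu p = +oo%E)].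

Definition otimes (R : realType) (nu1 nu2 : R -> \bar R) (p : R) : \bar R :=
  ereal_inf [set y | exists a b : R,
    [/\ 0 < a, 0 < b, a + b = 1 & y = (nu1 (p / a)%R * nu2 (p / b)%R)%E]].

Definition nu_sup (R : realType) (disp : measure_display)
    (T : measurableType disp) (P : probability T R) (n : option nat)
    (X : nat -> {RV P >-> R}) (p : R) : \bar R :=
  nnsup [set pnorm P p (X i) | i in times n].

(* zeta nu m is the function written \zeta_{m+1} when coordinates are numbered
   from 1. *)
Fixpoint zeta (R : realType) (nu : nat -> R -> \bar R) (m : nat) (p : R) :
    \bar R :=
  if m is m'.+1 then (K_M p * otimes (zeta nu m') (nu m) p)%E
  else (K_I p * nu 0%N p)%E.

Definition G_norm (R : realType) (disp : measure_display)
    (T : measurableType disp) (P : probability T R) (r : R)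
    (z : R -> \bar R) (X : T -> R) : \bar R :=
  nnsup [set (pnorm P p X / z p)%E | p in `]2, r[].

Definition G_norm_seq (R : realType) (disp : measure_display)
    (T : measurableType disp) (P : probability T R) (r : R)
    (z : R -> \bar R) (n : option nat) (X : nat -> {RV P >-> R}) : \bar R :=
  nnsup [set nnsup [set (pnorm P p (X i) / z p)%E | i in times n]
       | p in `]2, r[].

(* Main.v *)
(* Split each multi-index at its largest entry i:
   Q(d+1, n, b) = sum_i beta_i theta_i  with
   theta_i = Q(d, i-1, b(., i) / beta_i) xi(i, d+1)  and
   beta_i^2 = sum_J b(J, i)^2.
   The first factor of theta_i is F(i-1)-measurable, so the theta_i are again
   martingale differences and K_M(p) bounds |Q|_p by sup_i |theta_i|_p; Hoelder's
   inequality with exponents p/a and p/b and induction on d bound the latter by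
   the operation \otimes.  Integrability of theta_i comes from
   sum_m 1/r_m < 1 and a further use of Hoelder's inequality.  For n infinite,
   Fatou's lemma applies to the partial sums.  The right-hand side of the
   theorem is at least 1, since nu_m is itself the supremum of the norms. *)
Require Import Defs.
From HB Require Import structures.
From mathcomp Require Import all_boot all_order all_algebra finmap.
From mathcomp Require Import all_classical all_reals all_analysis.
From mathcomp Require Import measurable_realfun ring lra.

Set Implicit Arguments.
Unset Strict Implicit.
Unset Printing Implicit Defensive.
Import Order.TTheory GRing.Theory Num.Theory.
Import numFieldNormedType.Exports.
Local Open Scope classical_set_scope.
Local Open Scope ring_scope.

(** * Norms |X|_p on a probability space *)

Section pnorm_theory.
Context (R : realType) (disp : measure_display) (T : measurableType disp).
Variable P : probability T R.
Implicit Types (X Y : T -> R) (p : R).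
Local Open Scope ereal_scope.

Lemma pnormE p X : pnorm P p X = (\int[P]_x (`|X x| `^ p)%:E) `^ p^-1.
Proof. by rewrite /pnorm unlock /=. Qed.

Lemma pnorm_ge0 p X : 0 <= pnorm P p X.
Proof. exact: Lnorm_ge0. Qed.

Lemma measurable_normr_powR p X : measurable_fun setT X ->
  measurable_fun setT (fun x => `|X x| `^ p)%R.
Proof.
move=> mX; apply: (@measurableT_comp _ _ _ _ _ _ (@powR R ^~ p)) => //.
exact: measurableT_comp.
Qed.

Lemma le_pnorm p X Y : (0 < p)%R ->
  measurable_fun setT X -> measurable_fun setT Y ->
  (forall x, `|X x| <= `|Y x|)%R -> pnorm P p X <= pnorm P p Y.
Proof.
move=> p0 mX mY XY; rewrite !pnormE; apply: gt0_ler_poweR.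
- by rewrite invr_ge0 ltW.
- by rewrite in_itv/= leey andbT; apply: integral_ge0 => x _; rewrite lee_fin powR_ge0.
- by rewrite in_itv/= leey andbT; apply: integral_ge0 => x _; rewrite lee_fin powR_ge0.
- apply: ge0_le_integral => //.
  + by apply/measurable_EFinP; exact: measurable_normr_powR.
  + by apply/measurable_EFinP; exact: measurable_normr_powR.
  + by move=> x _; rewrite lee_fin ge0_ler_powR ?nnegrE// ltW.
Qed.

Lemma pnorm_eq0 p X : (0 < p)%R -> measurable_fun setT X ->
  pnorm P p X = 0 <-> {ae P, forall x, X x = 0%R}.
Proof.
move=> p0 mX; split=> [|X0].
  move/Lnorm_eq0_eq0; rewrite lte_fin => H.
  have {}H := H ((measurable_EFinP _ _).2 mX) p0.
  by apply: filterS H => x /(_ I) /= [].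
rewrite pnormE (ae_eq_integral (cst 0))//.
- by rewrite integral0 poweR0r// invr_neq0// gt_eqF.
- by apply/measurable_EFinP; exact: measurable_normr_powR.
- by apply: filterS X0 => x -> _ /=; rewrite normr0 powR0 ?gt_eqF.
Qed.

(** Classical Hoelder for |X|^p and |Y|^p with the conjugate exponents 1/a and 1/b, followed by a
    p-th root. The norms may be infinite. *)
Lemma pnorm_hoelder p a b X Y :
  measurable_fun setT X -> measurable_fun setT Y ->
  (0 < p)%R -> (0 < a)%R -> (0 < b)%R -> (a + b = 1)%R ->
  pnorm P p (fun x => X x * Y x)%R <= pnorm P (p / a) X * pnorm P (p / b) Y.
Proof.
move=> mX mY p0 a0 b0 ab.
(* Since (|Z|^p)^(1/c) = |Z|^(p/c), the p-th root of a norm of exponent 1/c is a norm of exponent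
   p/c. *)
have E c Z : (0 < c)%R -> 'N[P]_(c^-1%:E)[EFin \o (fun x => `|Z x| `^ p)%R] `^ p^-1 =
    pnorm P (p / c) Z.
  move=> c0; rewrite pnormE unlock /= -poweRrM invrK invf_div; congr (_ `^ _).
  by apply: eq_integral => x _; rewrite ger0_norm ?powR_ge0// -powRrM.
rewrite -!E// -poweRM; [|exact: Lnorm_ge0|exact: Lnorm_ge0].
rewrite pnormE; apply: gt0_ler_poweR.
- by rewrite invr_ge0 ltW.
- by rewrite in_itv/= leey andbT; apply: integral_ge0 => x _; rewrite lee_fin powR_ge0.
- by rewrite in_itv/= leey andbT mule_ge0// Lnorm_ge0.
have := @hoelder _ _ _ P _ _ a^-1 b^-1 (measurable_normr_powR p mX)
  (measurable_normr_powR p mY).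
rewrite !invr_gt0 !invrK => /(_ a0 b0 ab); apply: le_trans.
rewrite Lnorm1 le_eqVlt; apply/orP; left; apply/eqP; apply: eq_integral => x _ /=.
by rewrite -powRM// -normrM (ger0_norm (powR_ge0 _ _)).
Qed.

Lemma pnorm_lty_integrable X : measurable_fun setT X -> pnorm P 1 X < +oo ->
  P.-integrable setT (EFin \o X).
Proof.
move=> mX; rewrite /pnorm Lnorm1 => Xoo.
by apply/integrableP; split => //; exact/measurable_EFinP.
Qed.

End pnorm_theory.

(** * Increasing multi-indices and their largest entry *)

Lemma multi_indicesP (d n : nat) (I : d.-tuple nat) :
  multi_indices d (Some n) I <->
  sorted ltn I /\ all (fun i => (1 <= i <= n)%N) I.
Proof.
split=> -[sI HI]; split => //.
  by apply/all_tnthP => m; case: (HI m) => /= -> ->.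
by move=> m; move/all_tnthP: HI => /(_ m) /andP[].
Qed.

Lemma sorted_ltn_rcons (s : seq nat) (x : nat) :
  sorted ltn (rcons s x) = sorted ltn s && all (ltn^~ x) s.
Proof. by rewrite !(sorted_pairwise ltn_trans) pairwise_rcons andbC. Qed.

Lemma multi_indices0 (n : nat) : multi_indices 0 (Some n) = [set [tuple]].
Proof.
apply/seteqP; split=> I; first by rewrite [I]tuple0.
by move=> ->; split=> // -[].
Qed.

Lemma multi_indicesS0 (d : nat) : multi_indices d.+1 (Some 0%N) = set0.
Proof.
apply/seteqP; split=> // I [_ /(_ ord0)] [] /=.
by case: (tnth _ _).
Qed.

(** In an increasing tuple only the last entry can equal the bound [n.+1]; removing it leaves
    entries at most [n]. *)
Lemma multi_indicesSS (d n : nat) : multi_indices d.+1 (Some n.+1) =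
  multi_indices d.+1 (Some n) `|`
  (fun J => [tuple of rcons J n.+1]) @` multi_indices d (Some n).
Proof.
apply/seteqP; split=> I.
- move=> /multi_indicesP[sI aI].
  have [s [x Isx]] : exists s x, val I = rcons s x.
    case: I {sI aI} => s /= /eqP; case/lastP: s => // s x _.
    by exists s, x.
  have ss : size s == d.
    by have := size_tuple I; rewrite Isx size_rcons => -[->].
  move: sI aI; rewrite Isx sorted_ltn_rcons all_rcons.
  move=> /andP[sos ltx] /andP[/andP[x1 xn] as1].
  have [xn1|xn1] := eqVneq x n.+1.
    right; exists (Tuple ss); last by apply/val_inj; rewrite /= Isx xn1.
    apply/multi_indicesP; split => //; apply/allP => i is1.
    by have /andP[-> _] := allP as1 i is1; have := allP ltx i is1; rewrite xn1.
  left; apply/multi_indicesP; rewrite Isx sorted_ltn_rcons sos ltx all_rcons x1/=.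
  have {}xn : (x <= n)%N by rewrite -ltnS ltn_neqAle xn1.
  rewrite xn; split => //; apply/allP => i is1.
  have /andP[-> _] := allP as1 i is1.
  by rewrite (leq_trans (ltnW (allP ltx i is1))).
- case=> [/multi_indicesP[sI aI]|[J /multi_indicesP[sJ aJ] <-]].
    apply/multi_indicesP; split => //; apply: sub_all aI => i /andP[->].
    exact: leqW.
  apply/multi_indicesP; rewrite /= sorted_ltn_rcons sJ all_rcons/= ltnSn; split.
    by apply: sub_all aJ => i /andP[].
  by apply: sub_all aJ => i /andP[->]; exact: leqW.
Qed.

Lemma finite_multi_indices (d n : nat) : finite_set (multi_indices d (Some n)).
Proof.
elim: d n => [n|d IHd]; first by rewrite multi_indices0; exact: finite_set1.
elim=> [|n IHn]; first by rewrite multi_indicesS0; exact: finite_set0.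
rewrite multi_indicesSS finite_setU; split => //; exact: finite_image.
Qed.

(** Induction on [n]: the tuples ending in [n.+1] are disjoint from those bounded by [n]. As [i]
    starts at 1, [i.-1] is a true predecessor and says that the other entries lie strictly below
    [i]. *)
Lemma fsum_multi_indicesS (V : zmodType) (d n : nat) (G : d.+1.-tuple nat -> V) :
  \sum_(I \in multi_indices d.+1 (Some n)) G I =
  \sum_(1 <= i < n.+1) \sum_(J \in multi_indices d (Some i.-1))
    G [tuple of rcons J i].
Proof.
elim: n => [|n IHn]; first by rewrite multi_indicesS0 fsbig_set0 big_nil.
rewrite big_nat_recr//= -IHn multi_indicesSS fsbigU.
- congr (_ + _); rewrite fsbig_image// => I J _ _ /(congr1 val)/= IJ.
  by apply/val_inj; move/rcons_inj: IJ => [].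
- exact: finite_multi_indices.
- by apply: finite_image; exact: finite_multi_indices.
- move=> I [] /multi_indicesP[_ aI] [J _ JI].
  by move: aI; rewrite -JI all_rcons/= ltnn.
Qed.

(** * Functions measurable for a sub-sigma-algebra, and pulling them out of a conditional
    expectation *)

Section measurable_wrt_theory.
Context (R : realType) (disp : measure_display) (T : measurableType disp).
Variable G : set (set T).
Hypothesis sG : sigma_algebra setT G.

(** Generating from a sigma-algebra adds no sets, so measurability on [TG] is measurability with
    respect to [G], and the general facts on measurable functions carry over. *)
Let TG := g_sigma_algebraType G.

Lemma measurable_wrtP (X : T -> R) :
  measurable_wrt G X <-> measurable_fun setT (X : TG -> R).
Proof.
split=> mX.
  by move=> _ B mB; rewrite setTI; apply: sub_sigma_algebra; exact: mX.
move=> B mB; have := mX measurableT B mB.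
by rewrite setTI; rewrite /measurable/= sigma_algebra_id.
Qed.

Lemma measurable_wrtM (X Y : T -> R) :
  measurable_wrt G X -> measurable_wrt G Y ->
  measurable_wrt G (fun x => X x * Y x).
Proof.
move=> /measurable_wrtP mX /measurable_wrtP mY; apply/measurable_wrtP.
exact: measurable_funM.
Qed.

Lemma measurable_wrt_cst (c : R) : measurable_wrt G (fun=> c).
Proof. by apply/measurable_wrtP. Qed.

Lemma measurable_wrt_sum (I : eqType) (s : seq I) (h : I -> T -> R) :
  (forall i, i \in s -> measurable_wrt G (h i)) ->
  measurable_wrt G (fun x => \sum_(i <- s) h i x).
Proof.
elim: s => [_|i s IHs mh].
  by under eq_fun do rewrite big_nil; exact: measurable_wrt_cst.
under eq_fun do rewrite big_cons; apply/measurable_wrtP.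
apply: measurable_funD.
  by apply/measurable_wrtP; apply: mh; rewrite mem_head.
by apply/measurable_wrtP; apply: IHs => j js; apply: mh; rewrite inE js orbT.
Qed.

Lemma measurable_wrt_prod (I : eqType) (s : seq I) (h : I -> T -> R) :
  (forall i, i \in s -> measurable_wrt G (h i)) ->
  measurable_wrt G (fun x => \prod_(i <- s) h i x).
Proof.
move=> mh; apply/measurable_wrtP; apply: measurable_prod => i iS.
by apply/measurable_wrtP; exact: mh.
Qed.

Import HBNNSimple.

Hypothesis Gm : G `<=` measurable.

Lemma measurable_wrt_measurable (X : T -> R) :
  measurable_wrt G X -> measurable_fun setT X.
Proof. by move=> mX _ B mB; rewrite setTI; apply: Gm; exact: mX. Qed.

Variable P : probability T R.
Local Open Scope ereal_scope.

(* Simple functions of G first, then dominated convergence. *)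
Lemma ge0_integral_mul_eq0 (X Y : T -> R) (A : set T) :
  P.-integrable setT (EFin \o X) ->
  (forall B, G B -> \int[P]_(x in B) (X x)%:E = 0) ->
  measurable_wrt G Y -> (forall x, 0 <= Y x)%R ->
  P.-integrable setT (EFin \o (fun x => Y x * X x)%R) ->
  G A -> \int[P]_(x in A) (Y x * X x)%:E = 0.
Proof.
move=> iX X0 mY Y0 iXY GA.
have mA := Gm GA.
have mYE : measurable_fun setT (EFin \o (Y : TG -> R)).
  by apply/measurable_EFinP/measurable_wrtP.
pose Yn := nnsfun_approx measurableT mYE.
have mfT (f : TG -> R) : measurable_fun setT f -> measurable_fun setT (f : T -> R).
  by move=> mf; apply: measurable_wrt_measurable; exact/measurable_wrtP.
have mX : measurable_fun setT X by apply/measurable_EFinP; case/integrableP : iX.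
pose yn n : T -> R := (Yn n : TG -> R).
have mYn n : measurable_fun setT (yn n) by apply: mfT.
have yn0 n x : (0 <= yn n x)%R by rewrite /yn fun_ge0.
have yn_le n x : (yn n x <= Y x)%R.
  rewrite -lee_fin /yn /Yn (nnsfun_approxE measurableT mYE).
  by apply: (le_approx (f := EFin \o (Y : TG -> R))) => // y _; rewrite lee_fin.
have int0 n : \int[P]_(x in A) (yn n x * X x)%:E = 0.
  (* The approximation is built on [TG], so its level sets lie in [G] and the vanishing integrals of
     [X] apply on each of them. *)
  have GB c : G (A `&` yn n @^-1` [set c]).
    rewrite -(sigma_algebra_id sG); apply: (@measurableI _ TG).
      by rewrite /measurable/= sigma_algebra_id.
    exact: (@measurable_funPTI _ _ TG _ (Yn n)).
  have iB c : P.-integrable A ((EFin \o X) \_ (yn n @^-1` [set c])).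
    have mB : measurable (yn n @^-1` [set c]).
      by rewrite -[X in measurable X]setTI; apply: mYn.
    apply: (integrable_restrict _ mB mA _).1.
    by apply: integrableS iX => //; exact: measurableI.
  transitivity (\int[P]_(x in A) \sum_(c <- fset_set (range (yn n)))
      (c%:E * ((EFin \o X) \_ (yn n @^-1` [set c])) x)).
    apply: eq_integral => x _.
    rewrite /yn [in LHS](fimfunE (Yn n) x) fsbig_finite//= mulr_suml -sumEFin.
    apply: eq_bigr => c _; rewrite -mulrA EFinM; congr (_ * _).
    by rewrite patchE indicE; case: ifP => _; rewrite ?mul1r ?mul0r.
  rewrite integral_sum//; last by move=> c; exact: integrableZl.
  by rewrite big1// => c _; rewrite integralZl// -integral_mkcondr X0 ?mule0.
have [||||| _ _ /cvg_lim <-//] := @dominated_convergence _ _ _ P A mA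
  (fun n x => (yn n x * X x)%:E) (fun x => (Y x * X x)%:E)
  (abse \o (EFin \o (fun x => Y x * X x)%R)).
- move=> n; apply: measurable_funTS; apply/measurable_EFinP.
  exact: measurable_funM.
- apply: measurable_funTS; apply/measurable_EFinP.
  by apply: measurable_funM => //; exact: measurable_wrt_measurable.
- apply: aeW => x _; under eq_fun do rewrite EFinM; rewrite EFinM.
  apply: cvgeZr => //.
  by apply: (cvg_nnsfun_approx measurableT mYE) => // y _; rewrite lee_fin.
- by apply: integrable_abse; apply: integrableS iXY.
- apply: aeW => x n _ /=; rewrite lee_fin !normrM ler_wpM2r//.
  by rewrite !ger0_norm.
by under eq_fun do rewrite int0; rewrite lim_cst.
Qed.

(** This is E[YX | G] = Y E[X | G] = 0. Split Y into its positive and negative parts; each product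
    with X is dominated by |YX|, hence integrable. *)
Lemma integral_mul_eq0 (X Y : T -> R) (A : set T) :
  P.-integrable setT (EFin \o X) ->
  (forall B, G B -> \int[P]_(x in B) (X x)%:E = 0) ->
  measurable_wrt G Y ->
  P.-integrable setT (EFin \o (fun x => Y x * X x)%R) ->
  G A -> \int[P]_(x in A) (Y x * X x)%:E = 0.
Proof.
move=> iX X0 mY iXY GA.
have mX : measurable_fun setT X by apply/measurable_EFinP; case/integrableP : iX.
have mYT := measurable_wrt_measurable mY.
have ipart Z : measurable_wrt G Z -> (forall x, `|Z x| <= `|Y x|)%R ->
    P.-integrable setT (EFin \o (fun x => Z x * X x)%R).
  move=> mZ ZY; apply: le_integrable iXY => //.
    apply/measurable_EFinP; apply: measurable_funM => //.
    exact: measurable_wrt_measurable.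
  by move=> x _; rewrite lee_fin !normrM ler_wpM2r.
have mpos : measurable_wrt G (Y^\+)%R.
  by apply/measurable_wrtP; apply: measurable_funrpos; exact/measurable_wrtP.
have mneg : measurable_wrt G (Y^\-)%R.
  by apply/measurable_wrtP; apply: measurable_funrneg; exact/measurable_wrtP.
have ipos : P.-integrable setT (EFin \o (fun x => Y^\+ x * X x)%R).
  apply: ipart => // x; rewrite ger0_norm ?funrpos_ge0// /funrpos.
  by rewrite ge_max normr_ge0 ler_norm.
have ineg : P.-integrable setT (EFin \o (fun x => Y^\- x * X x)%R).
  apply: ipart => // x; rewrite ger0_norm ?funrneg_ge0// /funrneg.
  by rewrite ge_max normr_ge0 -normrN ler_norm.
have mA := Gm GA.
transitivity (\int[P]_(x in A)
    ((EFin \o (fun x => Y^\+ x * X x)%R) x - (EFin \o (fun x => Y^\- x * X x)%R) x)).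
  apply: eq_integral => x _ /=; rewrite -EFinB -mulrBl.
  by rewrite -[in LHS](funrposBneg Y).
rewrite integralB//; [|exact: integrableS ipos|exact: integrableS ineg].
by rewrite !ge0_integral_mul_eq0 ?sube0.
Qed.

End measurable_wrt_theory.

(** * The constants K_I and K_M: the lower bound 1, and the inequality for the infimum itself *)

Section best_constants.
Context (R : realType).
Local Open Scope ereal_scope.

(** A fair coin: its random sign has mean 0 and all norms equal to 1, which makes it a test variable
    for both constants. *)
Let B : probability bool R := bernoulli_prob 2^-1%R.

Let sgn (x : bool) : R := if x then 1%R else (-1)%R.

Let msgn : measurable_fun setT sgn. Proof. by []. Qed.

HB.instance Definition _ := @isMeasurableFun.Build _ _ _ _ sgn msgn.

Let BT : B setT = 1. Proof. exact: probability_setT. Qed.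

Let rademacher : {RV B >-> R} := sgn.

Let half01 : (0 <= (2^-1 : R) <= 1)%R.
Proof. by lra. Qed.

Let pnorm_rademacher p : (0 < p)%R -> pnorm B p rademacher = 1.
Proof.
move=> p0; rewrite pnormE; under eq_integral => x _.
  have -> : (`|rademacher x| = 1)%R by case: x; rewrite /= ?normrN normr1.
  rewrite powR1; over.
rewrite integral_cst// mul1e -[RHS](poweR1r p^-1); congr (_ `^ _); exact: BT.
Qed.

Let integrable_rademacher : B.-integrable setT (EFin \o rademacher).
Proof.
apply: measurable_bounded_integrable => //.
  by apply: (@le_lt_trans _ _ 1); rewrite ?ltry// -BT.
exists 1%R; split=> // M M1 x _; case: x => /=; rewrite ?normrN normr1; exact: ltW.
Qed.

Let integral_rademacher : \int[B]_x (rademacher x)%:E = 0.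
Proof.
(* The shift by 1 makes the integrand nonnegative, as the Bernoulli integral formula requires. *)
have -> : \int[B]_x (rademacher x)%:E = \int[B]_x ((rademacher x + 1)%:E - 1%:E).
  by apply: eq_integral => x _; rewrite -EFinB addrK.
have i1 : B.-integrable setT (fun=> 1%:E) by exact: finite_measure_integrable_cst.
have iS : B.-integrable setT (fun x => (rademacher x + 1)%:E).
  by under eq_fun do rewrite EFinD; exact: integrableD.
have int1 : \int[B]_x 1%:E = 1 by rewrite integral_cst// mul1e; exact: BT.
rewrite integralB// int1.
rewrite integral_bernoulli_prob//; last by case=> /=; rewrite lee_fin; lra.
by rewrite /= -!EFinM -!EFinD /unstable.onem; congr EFin; field.
Qed.

(** With a single summand of weight 1, the sum and the supremum of the norms are both 1. *)
Let rademacher_bound p K : (0 < p)%R ->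
  weighted_sum_bound p 1 (fun=> rademacher) K -> 1 <= K%:E.
Proof.
move=> p0 /(_ (fun=> 1%R)); rewrite big_nat1 expr1n => /(_ erefl).
have -> : (fun x => \sum_(1 <= i < 2) 1 * rademacher x)%R = rademacher :> (_ -> _).
  by apply/funext => x; rewrite big_nat1 mul1r.
rewrite pnorm_rademacher// => /le_trans; apply.
set S := nnsup _; suff -> : S = 1 by rewrite mule1.
apply/eqP; rewrite eq_le; apply/andP; split.
  by apply: ub_ereal_sup => _ [->//|[i _ <-]]; rewrite -(pnorm_rademacher p0).
by apply: ereal_sup_ubound; right; exists 1%N => //; exact: pnorm_rademacher.
Qed.

Lemma K_I_ge1 p : (0 < p)%R -> 1 <= K_I p :> \bar R.
Proof.
move=> p0; apply: le_ereal_inf_tmp => _ [K KP <-].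
apply: (rademacher_bound p0); apply: KP => [i _|J C J1 _].
  by split; [exact: integrable_rademacher|rewrite unlock; exact: integral_rademacher].
have [->|[j jJ]] := fset_0Vmem J.
  by rewrite set_fset0 bigcap_set0 BT big_seq_fset0.
(* The only time is 1, so independence is the trivial identity for one event. *)
have -> : J = [fset 1%N]%fset.
  have J1' i : i \in J -> i = 1%N.
    by move=> iJ; have [+ +] := J1 i iJ; case: i {iJ} => [|[]].
  apply/fsetP => i; rewrite in_fset1; apply/idP/eqP => [/J1'//|->].
  by rewrite -(J1' j jJ).
by rewrite set_fset1 bigcap_set1 big_seq_fset1.
Qed.

Lemma K_M_ge1 p : (0 < p)%R -> 1 <= K_M p :> \bar R.
Proof.
move=> p0; apply: le_ereal_inf_tmp => _ [K KP <-].
(* Nothing is known at time 0; from time 1 on every subset of [bool] is. *)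
pose F i : set (set bool) := if i is 0%N then [set set0; setT] else setT.
apply: (rademacher_bound p0); apply: (KP _ _ _ _ F).
  split=> //.
  - move=> [|i]; split => //.
    + by left.
    + by move=> A [] ->; rewrite ?setTD ?setC0 ?setTD ?setCT; [right|left].
    + move=> A FA; have [[i Ai]|] := pselect (exists i, A i = setT).
        by right; apply/seteqP; split=> // x _; exists i => //; rewrite Ai.
      move=> /forallNP A0; left; apply/seteqP; split=> // x [i _].
      by case: (FA i) => [->//|/A0].
move=> i [i1 ile1]; have -> : i = 1%N by case: i i1 ile1 => [|[]].
split.
- by move=> C _.
- exact: integrable_rademacher.
- by rewrite unlock; exact: integral_rademacher.
- case=> // _; split.
  - exact: integrable_rademacher.
  - exact: integrable0.
  - move=> C _; rewrite /F/=; have [C0|C0] := pselect (C 0%R).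
      by right; apply/seteqP; split.
    by left; apply/seteqP; split.
  - by move=> A [] ->; rewrite ?integral_set0// integral0 integral_rademacher.
Qed.

Context (disp : measure_display) (T : measurableType disp).
Variable P : probability T R.

(* 1 <= K excludes 0 * oo on the right-hand side; for S = 0 the product is 0
   even if no constant works (K = oo), so the sum must be shown to vanish a.e. *)
Lemma weighted_sum_inf (C : set R) (p : R) (n : nat)
    (theta : nat -> {RV P >-> R}) (b : nat -> R) (S : \bar R) :
  (0 < p)%R -> 1 <= ereal_inf [set K%:E | K in C] ->
  (forall K, C K -> weighted_sum_bound p n theta K) ->
  (\sum_(1 <= i < n.+1) b i ^+ 2 = 1)%R ->
  0 <= S -> (forall i, times (Some n) i -> pnorm P p (theta i) <= S) ->
  pnorm P p (fun x => \sum_(1 <= i < n.+1) b i * theta i x)%R <=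
    ereal_inf [set K%:E | K in C] * S.
Proof.
move=> p0 C1 CK b1 S0 thetaS.
have [->|Soo] := eqVneq S +oo.
  by rewrite gt0_muley ?leey// (lt_le_trans _ C1).
have [S00|Sn0] := eqVneq S 0.
  rewrite S00 mule0 le_eqVlt; apply/orP; left; apply/eqP.
  apply/pnorm_eq0 => //.
    by apply: measurable_sum => i; exact: measurable_funM.
  have t0 i : times (Some n) i -> {ae P, forall x, theta i x = 0%R}.
    move=> ti; apply/(pnorm_eq0 _ p0 (measurable_funP _)).
    by apply/eqP; rewrite eq_le pnorm_ge0 andbT -[leRHS]S00 thetaS.
  have : {ae P, forall x, forall i, times (Some n) i -> theta i x = 0%R}.
    apply/ae_foralln => i; have [/t0|ti] := pselect (times (Some n) i).
      by apply: filterS => x ->.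
    by apply: aeW.
  apply: filterS => x tx; rewrite big_nat big1// => i /andP[i1 iLn].
  by rewrite tx ?mulr0//; split.
have Sfin : S \is a fin_num by rewrite ge0_fin_numE// ltey.
have s0 : (0 < fine S)%R by rewrite fine_gt0// lt0e Sn0 S0 ltey.
rewrite -(fineK Sfin) -lee_pdivrMr//.
apply: le_ereal_inf_tmp => _ [K KC <-]; rewrite lee_pdivrMr//.
have K1 : 1 <= K%:E by apply: le_trans C1 _; apply: ereal_inf_lbound; exists K.
apply: (le_trans (CK K KC b b1)); rewrite lee_wpmul2l//.
  exact: le_trans K1.
rewrite fineK//; apply: ub_ereal_sup => _ [->//|[i ti <-]]; exact: thetaS.
Qed.

(** Truncations of a unit array have square sum at most 1. Normalise the weights by s, the root of
    their square sum; since s <= 1, scaling back only decreases the norm. If s = 0, all weights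
    vanish. *)
Lemma weighted_sum_inf_le (C : set R) (p : R) (n : nat)
    (theta : nat -> {RV P >-> R}) (b : nat -> R) (S : \bar R) :
  (0 < p)%R -> 1 <= ereal_inf [set K%:E | K in C] ->
  (forall K, C K -> weighted_sum_bound p n theta K) ->
  (\sum_(1 <= i < n.+1) b i ^+ 2 <= 1)%R ->
  0 <= S -> (forall i, times (Some n) i -> pnorm P p (theta i) <= S) ->
  pnorm P p (fun x => \sum_(1 <= i < n.+1) b i * theta i x)%R <=
    ereal_inf [set K%:E | K in C] * S.
Proof.
move=> p0 C1 CK; set s2 := (\sum_(1 <= i < n.+1) b i ^+ 2)%R => s1 S0 thetaS.
have ms (c : nat -> R) :
    measurable_fun setT (fun x => \sum_(1 <= i < n.+1) c i * theta i x)%R.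
  by apply: measurable_sum => i; exact: measurable_funM.
have s2_ge0 : (0 <= s2)%R by apply: sumr_ge0 => i _; exact: sqr_ge0.
have [s20|s20] := eqVneq s2 0%R.
  rewrite [leLHS](_ : _ = 0) ?mule_ge0 ?(le_trans _ C1)//.
  apply/pnorm_eq0 => //; apply: aeW => x; rewrite big_nat big1// => i iLn.
  move/eqP: s20; rewrite /s2 big_nat psumr_eq0; last by move=> j _; exact: sqr_ge0.
  move=> /allP/(_ i); rewrite mem_index_iota iLn sqrf_eq0 => /(_ isT)/eqP ->.
  by rewrite mul0r.
pose s := Num.sqrt s2; have s_gt0 : (0 < s)%R by rewrite sqrtr_gt0 lt0r s20.
have := @weighted_sum_inf C p n theta (fun i => b i / s)%R S p0 C1 CK _ S0 thetaS.
under eq_bigr do rewrite expr_div_n.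
rewrite -mulr_suml sqr_sqrtr// -/s2 divff// => /(_ erefl); apply: le_trans.
apply: le_pnorm => // x.
rewrite [leRHS](_ : _ = `|\sum_(1 <= i < n.+1) b i * theta i x| / s)%R; last first.
  rewrite -[X in (_ / X)%R](gtr0_norm s_gt0) -normf_div; congr (`|_|)%R.
  by rewrite mulr_suml; apply: eq_bigr => i _; rewrite mulrAC.
by rewrite ler_pdivlMr// ler_piMr// -sqrtr1 ler_wsqrtr.
Qed.

End best_constants.

(** * The polynomials: recursion in the degree, measurability and integrability *)

Section chaos.
Context (R : realType) (disp : measure_display) (T : measurableType disp).
Variable P : probability T R.
Local Open Scope ereal_scope.

(** Induction on the number of factors, splitting off the last one by Hoelder. The strict inequality
    for the reciprocals leaves slack to share between the two exponents. *)
Lemma pnorm_prod_lty (X : nat -> T -> R) (r : nat -> R) (m : nat) :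
  (forall j, (j < m)%N -> 0 < r j)%R ->
  (forall j, measurable_fun setT (X j)) ->
  (forall j q, (j < m)%N -> (1 <= q < r j)%R -> pnorm P q (X j) < +oo) ->
  forall q, (1 <= q)%R -> (\sum_(j < m) (r j)^-1 < q^-1)%R ->
  pnorm P q (fun x => \prod_(j < m) X j x)%R < +oo.
Proof.
move=> r0 mX; elim: m r0 => [|m IHm] r0 Xoo q q1 sq.
  have q0 : (0 < q)%R by exact: lt_le_trans q1.
  rewrite pnormE; under eq_integral do rewrite big_ord0 normr1 powR1.
  by rewrite integral_cst// mul1e /= probability_setT poweR1r ltry.
have q0 : (0 < q)%R by exact: lt_le_trans q1.
move: sq; rewrite big_ord_recr/=; set s := (\sum_(j < m) _)%R => sq.
have s0 : (0 <= s)%R.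
  by apply: sumr_ge0 => j _; rewrite invr_ge0 ltW// r0// ltnS ltnW.
have rm0 : (0 < (r m)^-1)%R by rewrite invr_gt0 r0.
(* Half of the slack: the Hoelder exponents then have reciprocals s + dlt and 1/r_m + dlt, which add
   up to 1/q and both keep a strict margin. *)
pose dlt := ((q^-1 - s - (r m)^-1) / 2)%R.
have dlt0 : (0 < dlt)%R by rewrite /dlt; lra.
have sd0 : (0 < s + dlt)%R by lra.
have rd0 : ((r m)^-1 + dlt > 0)%R by lra.
pose a := (q * (s + dlt))%R; pose b := (q * ((r m)^-1 + dlt))%R.
have a0 : (0 < a)%R by exact: mulr_gt0.
have b0 : (0 < b)%R by exact: mulr_gt0.
have ab : (a + b = 1)%R.
  rewrite /a /b -mulrDr -[RHS](divff (lt0r_neq0 q0)); congr (_ * _)%R.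
  by rewrite /dlt; lra.
have qa1 : (1 <= q / a)%R by rewrite ler_pdivlMr// mul1r; lra.
have qb1 : (1 <= q / b)%R by rewrite ler_pdivlMr// mul1r; lra.
have qaE : ((q / a)^-1 = s + dlt)%R.
  by rewrite invf_div /a mulrAC divff ?mul1r// lt0r_neq0.
have qbE : ((q / b)^-1 = (r m)^-1 + dlt)%R.
  by rewrite invf_div /b mulrAC divff ?mul1r// lt0r_neq0.
under [X in pnorm _ _ X]eq_fun do rewrite big_ord_recr/=.
apply: (le_lt_trans (@pnorm_hoelder _ _ _ P q a b _ _ _ _ q0 a0 b0 ab)) => //.
  by apply: measurable_prod => j _; exact: mX.
apply: lte_mul_pinfty; first exact: pnorm_ge0.
- rewrite ge0_fin_numE ?pnorm_ge0//; apply: IHm => //.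
  + by move=> j jm; apply: r0; rewrite ltnS ltnW.
  + by move=> j p jm; apply: Xoo; rewrite ltnS ltnW.
  + by rewrite qaE -/s ltrDl.
- by apply: Xoo => //; rewrite qb1/= -ltf_pV2 ?posrE ?r0 ?divr_gt0// qbE ltrDl.
Qed.

Variable xi : nat -> nat -> {RV P >-> R}.

Lemma Qfin0 (n : nat) (b : 0.-tuple nat -> R) : Qfin xi n b = cst (b [tuple]).
Proof.
apply/funext => x.
by rewrite /Qfin multi_indices0 fsbig_set1 big_ord0 mulr1.
Qed.

Lemma QfinS (d n : nat) (b : d.+1.-tuple nat -> R) (x : T) :
  (Qfin xi n b x = \sum_(1 <= i < n.+1)
    Qfin xi i.-1 (fun J => b [tuple of rcons J i]) x * xi i d x)%R.
Proof.
rewrite /Qfin fsum_multi_indicesS; apply: eq_bigr => i _.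
rewrite [RHS]mulrC mulr_fsumr; apply: eq_fsbigr => J _.
rewrite big_ord_recr/= [RHS]mulrC -mulrA; congr (_ * (_ * _))%R.
  apply: eq_bigr => m _; congr (xi _ _ x).
  by rewrite !(tnth_nth 0%N)/= nth_rcons size_tuple ltn_ord.
by rewrite (tnth_nth 0%N)/= nth_rcons size_tuple ltnn eqxx.
Qed.

Lemma Qfin_sum (d n : nat) (b : d.-tuple nat -> R) :
  Qfin xi n b = (fun x => \sum_(I <- fset_set (multi_indices d (Some n)))
    b I * \prod_(m < d) xi (tnth I m) m x)%R.
Proof. by apply/funext => x; rewrite /Qfin fsbig_finite//; exact: finite_multi_indices. Qed.

Lemma mem_fset_multi_indices (d n : nat) (I : d.-tuple nat) :
  I \in fset_set (multi_indices d (Some n)) -> multi_indices d (Some n) I.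
Proof. by rewrite in_fset_set ?inE//; exact: finite_multi_indices. Qed.

Lemma measurable_Qfin (d n : nat) (b : d.-tuple nat -> R) :
  measurable_fun setT (Qfin xi n b).
Proof.
rewrite Qfin_sum; apply: measurable_sum => I; apply: measurable_funM => //.
exact: measurable_prod.
Qed.

(** The product is a finite linear combination of products of [d.+1] variables, each of finite first
    moment by [pnorm_prod_lty] at exponent 1. *)
Lemma integrable_QfinM (r : nat -> R) (d k i : nat) (b : d.-tuple nat -> R) :
  (forall m, (m < d.+1)%N -> 0 < r m)%R ->
  (\sum_(m < d.+1) (r m)^-1 < 1)%R ->
  (forall m j q, (m < d.+1)%N -> (1 <= j <= maxn i k)%N -> (1 <= q < r m)%R ->
     pnorm P q (xi j m) < +oo) -> (0 < i)%N ->
  P.-integrable setT (EFin \o (fun x => Qfin xi k b x * xi i d x)%R).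
Proof.
move=> r0 r1 xioo i0.
pose M := fset_set (multi_indices d (Some k)).
(* The default value of [nth] matters: at position [d], past the end of [I], it returns [i], so one
   product over [d.+1] factors also covers [xi i d]. *)
rewrite (_ : _ \o _ = fun x => \sum_(I <- M | I \in M)
    (b I)%:E * (\prod_(m < d.+1) xi (nth i I m) m x)%:E); last first.
  apply/funext => x /=; rewrite Qfin_sum mulr_suml -sumEFin -big_seq.
  apply: eq_bigr => I _; rewrite -EFinM; congr EFin.
  rewrite big_ord_recr/= mulrA; congr (_ * _ * _)%R; last first.
    by rewrite nth_default// size_tuple.
  by apply: eq_bigr => m _; rewrite (tnth_nth i).
apply: integrable_sum => //= I /mem_fset_multi_indices MI.
apply: integrableZl => //; apply: pnorm_lty_integrable.
  by apply: measurable_prod => m _.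
apply: (@pnorm_prod_lty (fun m => xi (nth i I m) m) r) => //.
  move=> m q md; apply: xioo => //.
  move: md; rewrite ltnS leq_eqVlt => /predU1P[->|md].
    by rewrite nth_default ?size_tuple// i0 leq_maxl.
  have [+ +] := MI.2 (Ordinal md); rewrite (tnth_nth i)/= => -> /leq_trans; apply.
  exact: leq_maxr.
by rewrite invr1.
Qed.

(** The best constants quantify over bundled random variables, so the theta_i must be packaged as
    such. *)
Lemma exists_RV (X : T -> R) : measurable_fun setT X ->
  exists Y : {RV P >-> R}, Y = X :> (T -> R).
Proof.
move=> mX; pose mXmixin := @isMeasurableFun.Build _ _ _ _ X mX.
pose Y : {mfun T >-> R} := HB.pack X mXmixin.
by exists Y.
Qed.

End chaos.

(** * Suprema, filtrations and nonnegativity of zeta *)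

Lemma nnsup_ge0 (R : realType) (A : set (\bar R)) : (0 <= nnsup A)%E.
Proof. by apply: ereal_sup_ubound; left. Qed.

Lemma nnsup_ub (R : realType) (A : set (\bar R)) (y : \bar R) :
  A y -> (y <= nnsup A)%E.
Proof. by move=> Ay; apply: ereal_sup_ubound; right. Qed.

Lemma nnsup_le (R : realType) (A : set (\bar R)) (z : \bar R) :
  (0 <= z)%E -> (forall y, A y -> (y <= z)%E) -> (nnsup A <= z)%E.
Proof. by move=> z0 Az; apply: ub_ereal_sup => y [->//|/Az]. Qed.

Lemma nondecreasing_filtration (disp : measure_display)
    (T : measurableType disp) (F : nat -> set (set T)) (i j : nat) :
  filtration F -> (i <= j)%N -> F i `<=` F j.
Proof.
move=> [_ _ FS _]; elim: j => [|j IHj]; first by rewrite leqn0 => /eqP ->.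
rewrite leq_eqVlt => /predU1P[->//|]; rewrite ltnS => /IHj Fij.
exact: subset_trans (FS j).
Qed.

Lemma measurable_wrt_Qfin (R : realType) (disp : measure_display)
    (T : measurableType disp) (P : probability T R) (G : set (set T))
    (xi : nat -> nat -> {RV P >-> R}) (d n : nat) (b : d.-tuple nat -> R) :
  sigma_algebra setT G ->
  (forall m i, (m < d)%N -> (1 <= i <= n)%N -> measurable_wrt G (xi i m)) ->
  measurable_wrt G (Qfin xi n b).
Proof.
move=> sG mxi; rewrite Qfin_sum; apply: measurable_wrt_sum => // I.
move=> /mem_fset_multi_indices[_ MI].
apply: measurable_wrtM => //; first exact: measurable_wrt_cst.
apply: measurable_wrt_prod => // m _; apply: mxi => //.
by case: (MI m) => -> ->.
Qed.

(** Orthogonality to F(i-1) suffices: it contains F(k) for all k < i, and the whole space, which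
    gives mean zero. *)
Lemma martingale_differences_of (R : realType) (disp : measure_display)
    (T : measurableType disp) (P : probability T R) (n : option nat)
    (F : nat -> set (set T)) (X : nat -> {RV P >-> R}) :
  filtration F ->
  (forall i, times n i -> [/\ measurable_wrt (F i) (X i),
     P.-integrable setT (EFin \o X i) &
     forall A, F i.-1 A -> (\int[P]_(x in A) (X i x)%:E = 0)%E]) ->
  martingale_differences n F X.
Proof.
move=> hF HX i ti; have [mX iX X0] := HX i ti.
have [F0 sF _ _] := hF; split => //.
  rewrite unlock; apply: X0; apply: (nondecreasing_filtration hF (leq0n _)).
  by rewrite F0; right.
move=> k ki; split => //; first exact: integrable0.
  exact: measurable_wrt_cst.
move=> A FA; rewrite integral0 X0//.
by apply: (nondecreasing_filtration hF _ FA); rewrite -ltnS (ltn_predK ki).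
Qed.

Lemma otimes_ge0 (R : realType) (f g : R -> \bar R) (p : R) : 0 < p ->
  (forall q, 0 < q -> (0 <= f q)%E) -> (forall q, 0 < q -> (0 <= g q)%E) ->
  (0 <= otimes f g p)%E.
Proof.
move=> p0 f0 g0; apply: le_ereal_inf_tmp => _ [a [b [a0 b0 _ ->]]].
by rewrite mule_ge0 ?f0 ?g0 ?divr_gt0.
Qed.

Lemma zeta_ge0 (R : realType) (nu : nat -> R -> \bar R) (d : nat) (p : R) :
  0 < p -> (forall m q, (m <= d)%N -> 0 < q -> (0 <= nu m q)%E) ->
  (0 <= zeta nu d p)%E.
Proof.
elim: d p => [|d IHd] p p0 nu0 /=.
  by rewrite mule_ge0 ?nu0// (le_trans _ (K_I_ge1 p0)).
rewrite mule_ge0 ?(le_trans _ (K_M_ge1 p0))//.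
apply: otimes_ge0 => // q q0; last exact: nu0.
by apply: IHd => // m s md; apply: nu0; exact: leqW.
Qed.

(** * The moment bound at a finite horizon, by induction on the degree *)

Section moment_bound.
Context (R : realType) (disp : measure_display) (T : measurableType disp).
Variables (P : probability T R) (n : option nat) (F : nat -> set (set T)).
Variables (xi : nat -> nat -> {RV P >-> R}) (r : nat -> R).
Hypothesis hF : filtration F.

Let nu m := nu_sup n (fun i => xi i m).

Let nu_ge0 m p : (0 <= nu m p)%E.
Proof. exact: nnsup_ge0. Qed.

Let pnorm_le_nu m p i : times n i -> (pnorm P p (xi i m) <= nu m p)%E.
Proof. by move=> ti; apply: nnsup_ub; exists i. Qed.

(** The form is fitted to the induction: [otimes] evaluates at p/a for every a in (0,1), so p has no
    upper bound, and the square sum is only at most 1 because the normalised slices of [b] may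
    vanish. *)
Lemma pnorm_Qfin_le (d k : nat) (b : d.+1.-tuple nat -> R) (p : R) :
  (forall m, (m < d.+1)%N -> martingale_differences n F (fun i => xi i m)) ->
  independent_RVs (times n) (fun i => xi i 0%N) ->
  (forall m, (m < d.+1)%N -> 0 < r m) ->
  (forall m q, (m < d.+1)%N -> 1 <= q < r m -> (nu m q < +oo)%E) ->
  \sum_(m < d.+1) (r m)^-1 < 1 ->
  times (Some k) `<=` times n ->
  \sum_(I \in multi_indices d.+1 (Some k)) b I ^+ 2 <= 1 ->
  1 <= p -> (pnorm P p (Qfin xi k b) <= zeta nu d p)%E.
Proof.
move=> + hind; elim: d k b p => [|d IHd] k b p hxi r0 nuoo sr kn b1 p1.
  have p0 : 0 < p by exact: lt_le_trans p1.
  rewrite (_ : Qfin xi k b = fun x => \sum_(1 <= i < k.+1) b [tuple i] * xi i 0%N x).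
    rewrite [leRHS]/= [K_I p]/K_I; apply: weighted_sum_inf_le => //.
    - exact: K_I_ge1.
    - move=> K KP; apply: KP => [i /kn ti|J B Jk mB].
        by have [_ iX X0 _] := hxi 0%N isT i ti.
      by apply: hind => //; exact: subset_trans kn.
    - rewrite (le_trans _ b1)// fsum_multi_indicesS le_eqVlt.
      apply/orP; left; apply/eqP; apply: eq_bigr => i _.
      by rewrite multi_indices0 fsbig_set1; congr (b _ ^+ 2); exact/val_inj.
    - by move=> i /kn ti; exact: pnorm_le_nu.
  apply/funext => x; rewrite QfinS; apply: eq_bigr => i _.
  by rewrite Qfin0; congr (b _ * _); exact/val_inj.
have p0 : 0 < p by exact: lt_le_trans p1.
pose beta2 i := \sum_(J \in multi_indices d.+1 (Some i.-1))
  b [tuple of rcons J i] ^+ 2.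
have beta2_ge0 i : 0 <= beta2 i by apply: fsumr_ge0 => J _; exact: sqr_ge0.
pose beta i := Num.sqrt (beta2 i).
(* If [beta i] is 0, division by zero makes [c i] zero; the slice of [b] at [i] is then zero too, so
   [bE] holds in every case. *)
pose c i (J : d.+1.-tuple nat) := b [tuple of rcons J i] / beta i.
have bE i J : multi_indices d.+1 (Some i.-1) J ->
    b [tuple of rcons J i] = beta i * c i J.
  move=> MJ; have [bi0|bi0] := eqVneq (beta i) 0; last first.
    by rewrite /c mulrC divfK.
  have /eqP : beta2 i = 0.
    by apply/eqP; rewrite eq_le beta2_ge0 andbT -sqrtr_eq0 -/(beta i) bi0.
  rewrite /beta2 fsbig_finite/=; last exact: finite_multi_indices.
  rewrite psumr_eq0; last by move=> ? _; exact: sqr_ge0.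
  move=> /allP/(_ J); rewrite in_fset_set; last exact: finite_multi_indices.
  rewrite inE => /(_ MJ); rewrite sqrf_eq0 => /eqP ->.
  by rewrite bi0 mul0r.
have c1 i : \sum_(J \in multi_indices d.+1 (Some i.-1)) c i J ^+ 2 <= 1.
  have -> : \sum_(J \in multi_indices d.+1 (Some i.-1)) c i J ^+ 2 =
      beta2 i / beta2 i.
    rewrite [RHS]mulrC mulr_fsumr; apply: eq_fsbigr => J _.
    by rewrite expr_div_n sqr_sqrtr// mulrC.
  by have [->|b0] := eqVneq (beta2 i) 0; rewrite ?mul0r ?ler01// divff.
pose th i x := Qfin xi i.-1 (c i) x * xi i d.+1 x.
have mth i : measurable_fun setT (th i).
  by apply: measurable_funM => //; exact: measurable_Qfin.
have [theta thetaE] := choice (fun i => exists_RV P (mth i)).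
have QE : Qfin xi k b = fun x => \sum_(1 <= i < k.+1) beta i * theta i x.
  apply/funext => x; rewrite QfinS; apply: eq_bigr => i _.
  rewrite thetaE /th mulrA; congr (_ * _).
  rewrite /Qfin mulr_fsumr; apply: eq_fsbigr => J; rewrite inE => MJ.
  by rewrite (bE _ _ MJ) -mulrA.
have kn' i j : times (Some k) i -> times (Some i.-1) j -> times n j.
  move=> [i1 ik] [j1 ji]; apply: kn; split=> //.
  by rewrite (leq_trans ji)// (leq_trans (leq_pred _)).
have [_ sF _ Fm] := hF.
have Qpred i : times (Some k) i ->
    measurable_wrt (F i.-1) (Qfin xi i.-1 (c i)).
  move=> ti; apply: measurable_wrt_Qfin => // m j md /andP[j1 ji].
  have tj : times n j by apply: (kn' i) => //; split.
  have [mX _ _ _] := hxi m (leqW md) j tj.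
  by move=> B mB; apply: (nondecreasing_filtration hF ji); exact: mX.
rewrite QE [leRHS]/= [K_M p]/K_M; apply: weighted_sum_inf_le => //.
- exact: K_M_ge1.
- move=> K KP; apply: (KP _ _ _ _ F) => //.
  apply: martingale_differences_of => // i ti.
  have [mX iX _ ceX] := hxi d.+1 (ltnSn _) i (kn _ ti).
  have ith : P.-integrable setT (EFin \o th i).
    apply: (@integrable_QfinM _ _ _ _ _ r) => //; last by case: ti.
    move=> m j q md /andP[j1 ji] qr; apply: le_lt_trans (nuoo m q md qr).
    apply: pnorm_le_nu; apply: kn; split=> //.
    case: ti => _; apply: leq_trans; apply: (leq_trans ji).
    by rewrite geq_max leqnn leq_pred.
  rewrite thetaE; split => //.
    apply: measurable_wrtM => //.
    by move=> B mB; apply: (nondecreasing_filtration hF (leq_pred _)); exact: Qpred.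
  (* The polynomial factor only involves times up to i-1, so it can be pulled out of the
     conditioning on F(i-1). *)
  move=> A FA; apply: (@integral_mul_eq0 _ _ _ (F i.-1)) => //.
  + move=> B FB; have i1 : (i.-1 < i)%N by case: ti => + _; case: (i).
    by have [_ _ _ ->//] := ceX _ i1; rewrite integral0.
  + exact: Qpred.
- by rewrite (le_trans _ b1)// fsum_multi_indicesS ler_sum// => i _; rewrite sqr_sqrtr.
- by apply: otimes_ge0 => // q q0; apply: zeta_ge0.
- move=> i ti; rewrite thetaE.
  (* To stay below the infimum in [otimes], apply Hoelder for each split of 1; the induction
     hypothesis is used at p/a1, which is at least 1 because a1 < 1. *)
  apply: le_ereal_inf_tmp => _ [a1 [a2 [a1_gt0 a2_gt0 a12 ->]]].
  apply: le_trans (pnorm_hoelder _ _ _ p0 a1_gt0 a2_gt0 a12) _ => //.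
    exact: measurable_Qfin.
  apply: lee_pmul; rewrite ?pnorm_ge0//.
    apply: IHd => //.
    + by move=> m md; apply: hxi; exact: leqW.
    + by move=> m md; apply: r0; exact: leqW.
    + by move=> m q md; apply: nuoo; exact: leqW.
    + apply: le_lt_trans sr; rewrite [leRHS]big_ord_recr/= lerDl invr_ge0.
      by rewrite ltW// r0.
    + by move=> j; exact: kn'.
    + by rewrite ler_pdivlMr// mul1r; lra.
  by apply: pnorm_le_nu; exact: kn.
Qed.

End moment_bound.

(** * Passage to the limit in the norms by Fatou *)

Section fatou_pnorm.
Context (R : realType) (disp : measure_display) (T : measurableType disp).
Variable P : probability T R.
Local Open Scope ereal_scope.
Import HBNNSimple.

(* No measurability of f is asked for: its integral is a supremum over the
   simple functions below f. *)
Lemma ae_ge0_integral_le (f g : T -> \bar R) : (forall x, 0 <= f x) ->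
  measurable_fun setT g -> (forall x, 0 <= g x) ->
  {ae P, forall x, f x <= g x} -> \int[P]_x f x <= \int[P]_x g x.
Proof.
move=> f0 mg g0 fg; rewrite [leLHS]ge0_integralTE//.
apply: ge_ereal_sup => _ [h /= hf <-]; rewrite -integralT_nnsfun.
apply: ae_ge0_le_integral => //.
- by move=> x _; rewrite lee_fin; exact: fun_ge0.
- by apply/measurable_EFinP; exact: measurable_funP.
- by apply: filterS fg => x fgx _; exact: le_trans (hf x) fgx.
Qed.

(** Fatou for |X_k|^p, whose integrals are at most z^p; the lower limit dominates |Y|^p almost
    everywhere. *)
Lemma pnorm_lim_le (p : R) (X : nat -> T -> R) (Y : T -> R) (z : \bar R) :
  (0 < p)%R -> 0 <= z -> (forall k, measurable_fun setT (X k)) ->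
  (forall k, pnorm P p (X k) <= z) ->
  {ae P, forall x, (fun k => X k x) @ \oo --> Y x} ->
  pnorm P p Y <= z.
Proof.
move=> p0 z0 mX Xz XY.
have [->|zoo] := eqVneq z +oo; first exact: leey.
have zpp : (z `^ p) `^ p^-1 = z by rewrite -poweRrM divff ?poweRe1// gt_eqF.
have pitv (y : \bar R) : 0 <= y -> y \in `[0, +oo] by rewrite in_itv/= leey andbT.
pose u k x := (`|X k x| `^ p)%:E.
have mu k : measurable_fun setT (u k).
  by apply/measurable_EFinP; exact: measurable_normr_powR.
have u0 k x : 0 <= u k x by rewrite lee_fin powR_ge0.
have iu k : \int[P]_x u k x <= z `^ p.
  rewrite -[leLHS](@poweRe1 R) ?integral_ge0// -(mulVf (lt0r_neq0 p0)) poweRrM -pnormE.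
  by apply: gt0_ler_poweR (Xz k); rewrite ?pitv ?pnorm_ge0// ltW.
rewrite pnormE -zpp; apply: gt0_ler_poweR; rewrite ?invr_ge0 ?(ltW p0)//.
- by apply: pitv; apply: integral_ge0 => x _; rewrite lee_fin powR_ge0.
- by apply: pitv; exact: poweR_ge0.
have einf_ge0 x : 0 <= limn_einf (u ^~ x).
  rewrite limn_einf_lim; apply: lime_ge; first exact: is_cvg_einfs.
  by apply: nearW => k; apply: le_ereal_inf_tmp => _ [j _ <-].
apply: (@le_trans _ _ (\int[P]_x limn_einf (u ^~ x))).
  apply: ae_ge0_integral_le => //.
  - apply: (emeasurable_fun_cvg (fun k x => einfs (u ^~ x) k)).
      by move=> k; exact: measurable_fun_einfs.
    by move=> x _; rewrite limn_einf_lim; exact: is_cvg_einfs.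
  - apply: filterS XY => x Xx.
    (* Continuity of the power is obtained from differentiability, available away from 0; where Y
       vanishes, nonnegativity of the lower limit is enough. *)
    have [->|Yx0] := eqVneq (Y x) 0%R; first by rewrite normr0 powR0// gt_eqF.
    have ux : u ^~ x @ \oo --> (`|Y x| `^ p)%:E.
      apply: cvg_EFin; first exact: nearW.
      apply: (@continuous_cvg _ _ _ _ _ _ (@powR R ^~ p)); last exact: cvg_norm.
      apply: differentiable_continuous; apply/derivable1_diffP.
      by apply: derivable_powR; rewrite in_itv/= normr_gt0 Yx0.
    by rewrite is_cvg_limn_einfE ?(cvg_lim _ ux)//; apply/cvg_ex; eexists; exact: ux.
apply: (le_trans (fatou P measurableT mu _)) => //.
rewrite limn_einf_lim; apply: lime_le; first exact: is_cvg_einfs.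
apply: nearW => k; apply: le_trans (iu k).
by apply: ereal_inf_lbound; exists k => /=.
Qed.

End fatou_pnorm.

(** * Comparison of both sides with 1, and the theorem *)

Lemma G_norm_seq_ge1 (R : realType) (disp : measure_display)
    (T : measurableType disp) (P : probability T R) (r : R) (n : option nat)
    (X : nat -> {RV P >-> R}) :
  2 < r -> class_G r (nu_sup n X) -> (1 <= G_norm_seq r (nu_sup n X) n X)%E.
Proof.
move=> r2 [_ nuoo _ _]; pose p := (2 + r) / 2.
have p2r : 2 < p < r by rewrite /p; apply/andP; split; lra.
have /nuoo : 1 <= p < r by rewrite /p; apply/andP; split; lra.
case E : (nu_sup n X p) => [v| |]; rewrite ?ltxx ?andbF// lte_fin => /andP[v0 _].
apply: (@le_trans _ _
    (nnsup [set (pnorm P p (X i) / nu_sup n X p)%E | i in times n])); last first.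
  by apply: nnsup_ub; exists p => //=; rewrite in_itv.
set s := nnsup _.
have : (nu_sup n X p <= s * v%:E)%E.
  apply: nnsup_le => [|_ [i ti <-]].
    by rewrite mule_ge0 ?nnsup_ge0// lee_fin ltW.
  rewrite -lee_pdivrMr//; apply: nnsup_ub; exists i => //.
  by rewrite E inver gt_eqF.
by rewrite E -lee_pdivrMr// -EFinM divff// gt_eqF.
Qed.

Lemma prode_ge1 (R : realType) (d : nat) (f : nat -> \bar R) :
  (forall m, (m < d)%N -> (1 <= f m)%E) -> (1 <= \prod_(m < d) f m)%E.
Proof.
move=> f1; elim/big_ind : _ => // [x y x1 y1|m _]; last exact: f1.
by rewrite -[leLHS]mule1 lee_pmul.
Qed.

(** Degenerate denominators are harmless: z = +oo makes the quotient 0, and z = 0 forces x = 0,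
    hence again a quotient 0. *)
Lemma dive_le1 (R : realType) (x z : \bar R) :
  (0 <= x)%E -> (x <= z)%E -> (x / z <= 1)%E.
Proof.
move=> x0 xz; case: z xz => [v xv| _|]; last 2 first.
- by rewrite invey mule0 lee01.
- by rewrite leeNy_eq => /eqP xNy; rewrite xNy in x0.
have v0 : 0 <= v by rewrite -lee_fin (le_trans x0).
have [v00|vn0] := eqVneq v 0.
  rewrite v00 in xv *; have -> : x = 0%E by apply/eqP; rewrite eq_le xv.
  by rewrite mul0e lee01.
by rewrite inver (negPf vn0) lee_pdivrMr ?mul1e// lt0r vn0.
Qed.

Lemma fsum_unit_array_le1 (R : realType) (d k : nat) (n : option nat)
    (b : d.-tuple nat -> R) :
  times (Some k) `<=` times n -> unit_arrays R d n b ->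
  \sum_(I \in multi_indices d (Some k)) b I ^+ 2 <= 1.
Proof.
move=> kn b1; rewrite -lee_fin -b1 -fsumEFin; last exact: finite_multi_indices.
apply: esum_ge; exists (multi_indices d (Some k)) => //; split.
  exact: finite_multi_indices.
by move=> I [sI tI]; split=> // m; exact: kn.
Qed.

Theorem theorem4p2 (R : realType) (disp : measure_display)
  (T : measurableType disp) (P : probability T R)
  (d : nat) (n : option nat) (F : nat -> set (set T))
  (xi : nat -> nat -> {RV P >-> R}) (r : nat -> R)
  (hd : (1 <= d)%N)
  (hn : if n is Some k then (1 <= k)%N else true)
  (hF : filtration F)
  (hxi : forall m, (m < d)%N -> martingale_differences n F (fun i => xi i m))
  (hind : forall m, (m < d)%N -> independent_RVs (times n) (fun i => xi i m))
  (hr : forall m, (m < d)%N -> 2 < r m)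
  (hnu : forall m, (m < d)%N -> class_G (r m) (nu_sup n (fun i => xi i m)))
  (hrr : 1 < (\sum_(m < d) (r m)^-1)^-1) :
  let nu m := nu_sup n (fun i => xi i m) in
  (nnsup [set G_norm P (\sum_(m < d) (r m)^-1)^-1 (zeta nu d.-1) (Q xi n b)
         | b in unit_arrays R d n `&` [set b | Q_defined xi n b]]
   <= \prod_(m < d) G_norm_seq (r m) (nu m) n (fun i => xi i m))%E.
Proof.
cbv zeta; apply: (@le_trans _ _ 1%E); last first.
  apply: (@prode_ge1 _ d (fun m =>
      G_norm_seq (r m) (nu_sup n (fun i => xi i m)) n (fun i => xi i m))) => m md.
    by apply: G_norm_seq_ge1; [exact: hr|exact: hnu].
apply: nnsup_le => // y [b [b1 bQ] <-].
apply: nnsup_le => // z [p /=]; rewrite in_itv/= => /andP[p2 _] <-.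
apply: dive_le1; first exact: pnorm_ge0.
have sr : \sum_(m < d) (r m)^-1 < 1.
  rewrite -invf_gt1// -invr_gt0; exact: lt_trans hrr.
have p1 : 1 <= p by lra.
pose nu m := nu_sup n (fun i => xi i m).
(* Stated for every truncation within the horizon: a finite horizon is itself one, and an infinite
   one is reached through the almost sure limit supplied by [bQ]. *)
have bound k : times (Some k) `<=` times n ->
    (pnorm P p (Qfin xi k b) <= zeta nu d.-1 p)%E.
  move=> kn; have := fsum_unit_array_le1 kn b1.
  case: d hd hxi hind hr hnu sr b {b1 bQ hrr} => // d _ hxi hind hr hnu sr b b1.
  apply: (@pnorm_Qfin_le _ _ _ _ _ F _ r) => //.
  - exact: hind.
  - by move=> m md; apply: lt_trans (hr m md).
  - by move=> m q md qr; have [_ /(_ q qr)/andP[]] := hnu m md.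
case: n b1 bQ @nu bound {hn hxi hind hnu} => [k|] b1 bQ nu bound /=.
  exact: bound.
apply: (@pnorm_lim_le _ _ _ P p (fun k => Qfin xi k b)) => //; first lra.
- apply: zeta_ge0; first lra.
  by move=> *; exact: nnsup_ge0.
- by move=> k; exact: measurable_Qfin.
- by move=> k; apply: bound => i [].
Qed.
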